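(* Let $f:[0,\infty)\to[0,\infty)$ be $2$-radical convex. If $n\ge 1$, $x_1,\ldots,x_n\ge 0$ and $0\le w_1,\ldots,w_n\le 1$ are such that $\sum_{i=1}^n w_i=1$, then $$f\left(\sum_{i=1}^n w_ix_i\right)\le \sum_{i=1}^n w_i\left\{f\left(\frac{\sum_{j=1}^n w_jx_j+x_i}{2}\right)+f\left(\frac{\left|\sum_{j=1}^n w_jx_j-x_i\right|}{2}\right)\right\}\le \sum_{i=1}^n w_if(x_i).$$
   Context: Let $p\ge 1$. A continuous function $f:[0,\infty)\to[0,\infty)$ with $f(0)=0$ is called $p$-radical convex if the function $x\mapsto f\left(x^{1/p}\right)$ is convex on $[0,\infty)$. In particular $f$ is $2$-radical convex if $x\mapsto f(\sqrt{x})$ is convex on $[0,\infty)$. *)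

(* Defs.v *)
From HB Require Import structures.
From mathcomp Require Import all_boot all_order all_algebra.
From mathcomp Require Import all_classical all_reals all_analysis.

Set Implicit Arguments.
Unset Strict Implicit.
Unset Printing Implicit Defensive.

Import Order.TTheory GRing.Theory Num.Theory.
Import numFieldNormedType.Exports.

Local Open Scope classical_set_scope.
Local Open Scope ring_scope.

(* A function [0, +oo[ -> [0, +oo[ is represented by f : R -> R, of which only
   the values on [0, +oo[ are constrained: continuity is that of the
   restriction of f to `[0, +oo[. The notion is meant for 1 <= p. *)
Record radical_convex (R : realType) (p : R) (f : R -> R) : Prop :=
  RadicalConvex {
    radical_convex_ge0 : forall x, 0 <= x -> 0 <= f x ;
    radical_convex_continuous : {within `[0, +oo[, continuous f} ;
    radical_convex_f0 : f 0 = 0 ;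
    radical_convexP :
      convex_function (`[0, +oo[ : set R^o) (fun x : R^o => f (x `^ p^-1))
  }.

Lemma radical_convex2_sqrt (R : realType) (f : R -> R) :
  radical_convex 2 f ->
  convex_function (`[0, +oo[ : set R^o) (fun x : R^o => f (Num.sqrt x)).
Proof.
move=> [_ _ _ cf] t x y x0 y0; have := cf t x y x0 y0.
have {}x0 : 0 <= (x : R) by move: x0; rewrite inE /= in_itv /= andbT.
have {}y0 : 0 <= (y : R) by move: y0; rewrite inE /= in_itv /= andbT.
rewrite !powR12_sqrt//.
by apply: addr_ge0; apply: mulr_ge0 => //; rewrite subr_ge0.
Qed.

(* Main.v *)
Require Import Defs.
From HB Require Import structures.
From mathcomp Require Import all_boot all_order all_algebra.
From mathcomp Require Import all_classical all_reals all_analysis.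
From mathcomp Require Import ring lra.

(** Let [m] be the weighted mean.  As [f] vanishes at [0] and is convex in the
    square of its argument, [f a / a ^ 2] is nondecreasing; hence [f] is
    nondecreasing, convex, and superadditive in the squares of its arguments.
    Left inequality: the average of the points [(m + x i) / 2] is [m], so Jensen
    already bounds [f m] by the first summands.
    Right inequality: the squares of [(m + x i) / 2] and [`|m - x i| / 2] add up
    to the average of [m ^ 2] and [x i ^ 2], so the bracket is at most
    [(f m + f (x i)) / 2], and Jensen bounds [f m]. *)

Import Order.TTheory GRing.Theory Num.Theory.

Local Open Scope ring_scope.

(** Points are added one at a time: each is merged with the mean of the earlier ones, which stays
    nonnegative, so convexity is only used on nonnegative reals. *)
Lemma jensen_nonneg (R : realFieldType) (f : R -> R) (I : finType) (x w : I -> R) :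
  (forall t a b : R, 0 <= t <= 1 -> 0 <= a -> 0 <= b ->
     f (t * a + (1 - t) * b) <= t * f a + (1 - t) * f b) ->
  (forall i, 0 <= x i) -> (forall i, 0 <= w i) -> \sum_i w i = 1 ->
  f (\sum_i w i * x i) <= \sum_i w i * f (x i).
Proof.
move=> cvxf x0 w0 w1.
(* Division-free invariant for unnormalized partial sums: [y] is their mean. *)
have : [/\ 0 <= \sum_i w i & exists2 y : R, 0 <= y &
    \sum_i w i * x i = (\sum_i w i) * y /\
    (\sum_i w i) * f y <= \sum_i w i * f (x i)].
  elim/big_rec3: _ => [|i F X S _ [S0 [y y0 [XE leF]]]].
    by split=> //; exists 0 => //; rewrite !mul0r.
  have wi0 := w0 i; split; first exact: addr_ge0.
  (* Zero total weight forces [w i] and [S] to vanish, so the old [y] still serves. *)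
  have [T0|TN0] := eqVneq (w i + S) 0.
    have /andP[/eqP-> /eqP SE] : (w i == 0) && (S == 0).
      by move/eqP: T0; rewrite paddr_eq0.
    exists y => //; rewrite XE SE; split; first by ring.
    by move: leF; rewrite SE !(mul0r, add0r).
  have Tgt0 : 0 < w i + S by rewrite lt_neqAle eq_sym TN0 addr_ge0.
  pose t := w i / (w i + S).
  have t01 : 0 <= t <= 1.
    by rewrite divr_ge0 ?(ltW Tgt0)//= ler_pdivrMr// mul1r lerDl.
  exists (t * x i + (1 - t) * y).
    by case/andP: t01 => ? ?; rewrite addr_ge0// mulr_ge0// subr_ge0.
  split; first by rewrite XE /t; field.
  apply: le_trans (ler_wpM2l (ltW Tgt0) (cvxf _ _ _ t01 (x0 i) y0)) _.
  suff -> : (w i + S) * (t * f (x i) + (1 - t) * f y) = w i * f (x i) + S * f y.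
    by rewrite lerD2l.
  by rewrite /t; field.
by rewrite w1 => -[_ [y _ []]]; rewrite !mul1r => ->.
Qed.

Section RadicalConvex2.
Context {R : realType} {f : R -> R} (hf : radical_convex 2 f).

(** Convexity of [f] after the square root, at the points [a ^+ 2] and [b ^+ 2]; the root [c] may be
    supplied in any form. *)
Lemma radical_convex2_sqr (t a b c : R) :
  0 <= t <= 1 -> 0 <= a -> 0 <= b -> 0 <= c ->
  c ^+ 2 = t * a ^+ 2 + (1 - t) * b ^+ 2 ->
  f c <= t * f a + (1 - t) * f b.
Proof.
move=> /andP[t0 t1] a0 b0 c0 cE.
have tI : Itv.spec (@Itv.num_sem R) (Itv.Real `[0%Z, 1%Z]) t.
  by rewrite /Itv.spec/= /Itv.num_sem/= ger0_real//= in_itv/= t0 t1.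
have sqr_in z : z ^+ 2 \in (`[0, +oo[%classic : set R^o).
  by rewrite inE/= in_itv/= andbT sqr_ge0.
have /= := radical_convex2_sqrt hf (Itv.mk tI) (sqr_in a) (sqr_in b).
have -> : conv (Itv.mk tI) (a ^+ 2 : convex_lmodType R^o) (b ^+ 2) = c ^+ 2.
  by rewrite cE.
by rewrite convRE/= /unstable.onem !sqrtr_sqr !ger0_norm.
Qed.

(** Monotonicity of [f a / a ^+ 2], cleared of denominators so that zero is allowed. *)
Lemma radical_convex2_scale (a b : R) :
  0 <= a <= b -> b ^+ 2 * f a <= a ^+ 2 * f b.
Proof.
move=> /andP[a0 leab].
have [bE|bN0] := eqVneq b 0.
  have -> : a = 0 by apply/eqP; rewrite eq_le a0 -bE leab.
  by rewrite bE.
have b0 : 0 < b by rewrite lt_neqAle eq_sym bN0 (le_trans a0).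
have b20 : 0 < b ^+ 2 by rewrite exprn_gt0.
(* [a ^+ 2] lies between [0] and [b ^+ 2], with weight [a ^+ 2 / b ^+ 2] on the latter; the term at
   [0] drops out. *)
have := @radical_convex2_sqr (a ^+ 2 / b ^+ 2) b 0 a.
rewrite (radical_convex_f0 hf) mulr0 addr0 expr0n/= mulr0 addr0.
rewrite divr_ge0 ?sqr_ge0//= ler_pdivrMr// mul1r ler_sqr ?nnegrE ?(ltW b0)//.
rewrite divfK ?(gt_eqF b20)// => /(_ leab isT (lexx 0) a0 erefl).
by rewrite mulrAC ler_pdivlMr// mulrC.
Qed.

Lemma radical_convex2_homo (a b : R) : 0 <= a <= b -> f a <= f b.
Proof.
move=> /andP[a0 leab]; have b0 := le_trans a0 leab.
have [bE|bN0] := eqVneq b 0.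
  have -> : a = 0 by apply/eqP; rewrite eq_le a0 -bE leab.
  by rewrite bE.
have b20 : 0 < b ^+ 2 by rewrite exprn_gt0// lt_neqAle eq_sym bN0.
rewrite -(ler_pM2l b20).
apply: le_trans (radical_convex2_scale _ _ _) _; first by rewrite a0.
by rewrite ler_wpM2r ?(radical_convex_ge0 hf)// ler_sqr.
Qed.

(** Scaling [a] and [b] against [c] and adding gives [c ^+ 2 * (f a + f b) <= (a ^+ 2 + b ^+ 2) * f
    c]. *)
Lemma radical_convex2_superadd (a b c : R) :
  0 <= a -> 0 <= b -> 0 <= c -> a ^+ 2 + b ^+ 2 = c ^+ 2 -> f a + f b <= f c.
Proof.
move=> a0 b0 c0 abc.
have leac : 0 <= a <= c by rewrite a0/= -ler_sqr// -abc lerDl sqr_ge0.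
have lebc : 0 <= b <= c by rewrite b0/= -ler_sqr// -abc lerDr sqr_ge0.
have [cE|cN0] := eqVneq c 0.
  have [-> ->] : a = 0 /\ b = 0 by split; apply/eqP; rewrite eq_le; rewrite cE in leac lebc; rewrite andbC.
  by rewrite cE (radical_convex_f0 hf) addr0.
have c20 : 0 < c ^+ 2 by rewrite exprn_gt0// lt_neqAle eq_sym cN0.
rewrite -(ler_pM2l c20) mulrDr -[X in _ <= X * _]abc mulrDl.
exact: lerD (radical_convex2_scale _ _ leac) (radical_convex2_scale _ _ lebc).
Qed.

(** The weighted mean is at most the quadratic mean; monotonicity passes to the latter, where
    convexity in the square applies. *)
Lemma radical_convex2_convex (t a b : R) :
  0 <= t <= 1 -> 0 <= a -> 0 <= b ->
  f (t * a + (1 - t) * b) <= t * f a + (1 - t) * f b.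
Proof.
move=> t01 a0 b0; case/andP: (t01) => t0 t1.
have ut0 : 0 <= 1 - t by rewrite subr_ge0.
have s0 : 0 <= t * a ^+ 2 + (1 - t) * b ^+ 2.
  by rewrite addr_ge0// mulr_ge0// sqr_ge0.
have m0 : 0 <= t * a + (1 - t) * b by rewrite addr_ge0// mulr_ge0.
apply: (@le_trans _ _ (f (Num.sqrt (t * a ^+ 2 + (1 - t) * b ^+ 2)))).
  apply: radical_convex2_homo; rewrite m0/= -ler_sqr ?nnegrE ?sqrtr_ge0//.
  rewrite sqr_sqrtr// -subr_ge0.
  (* The gap is the variance of the two-point distribution. *)
  have -> : t * a ^+ 2 + (1 - t) * b ^+ 2 - (t * a + (1 - t) * b) ^+ 2
            = t * (1 - t) * (a - b) ^+ 2 by ring.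
  by rewrite mulr_ge0 ?sqr_ge0// mulr_ge0.
by apply: radical_convex2_sqr => //; rewrite ?sqrtr_ge0// sqr_sqrtr.
Qed.

Lemma radical_convex2_parallelogram (m x : R) :
  0 <= m -> 0 <= x ->
  f ((m + x) / 2) + f (`|m - x| / 2) <= 2^-1 * f m + 2^-1 * f x.
Proof.
move=> m0 x0.
pose s := 2^-1 * m ^+ 2 + 2^-1 * x ^+ 2.
have s0 : 0 <= s by rewrite addr_ge0// mulr_ge0// ?invr_ge0// sqr_ge0.
have half : 1 - 2^-1 = 2^-1 :> R by field.
apply: (@le_trans _ _ (f (Num.sqrt s))).
  apply: (radical_convex2_superadd _ _ _ _ _ (sqrtr_ge0 s)).
  - by rewrite divr_ge0// addr_ge0.
  - by rewrite divr_ge0.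
  - by rewrite (sqr_sqrtr s0) !expr_div_n real_normK ?num_real// /s; field.
rewrite -[X in _ + X * _]half; apply: radical_convex2_sqr => //.
- by apply/andP; split; lra.
- by rewrite sqr_sqrtr// half.
Qed.

End RadicalConvex2.

Theorem theorem2p1 (R : realType) (f : R -> R) (n : nat) (x w : 'I_n -> R)
  (hf : radical_convex 2 f)
  (hn : (1 <= n)%N)
  (hx : forall i, 0 <= x i)
  (hw : forall i, 0 <= w i <= 1)
  (hsum : \sum_(i < n) w i = 1) :
  f (\sum_(i < n) w i * x i)
    <= \sum_(i < n) w i * (f ((\sum_(j < n) w j * x j + x i) / 2)
                           + f (`|\sum_(j < n) w j * x j - x i| / 2))
    <= \sum_(i < n) w i * f (x i).
Proof.
have w0 i : 0 <= w i by case/andP: (hw i).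
have cvxf := @radical_convex2_convex R f hf.
set m := \sum_(j < n) w j * x j.
have m0 : 0 <= m by apply: sumr_ge0 => i _; rewrite mulr_ge0.
have mx0 i : 0 <= (m + x i) / 2 by rewrite divr_ge0// addr_ge0.
apply/andP; split.
  have mE : \sum_(i < n) w i * ((m + x i) / 2) = m.
    under eq_bigr => i _ do rewrite mulrA mulrDr.
    by rewrite -mulr_suml big_split/= -mulr_suml hsum -/m; field.
  have := jensen_nonneg _ _ _ _ _ cvxf mx0 w0 hsum; rewrite mE => /le_trans; apply.
  (* The second summand of each bracket is nonnegative and is dropped. *)
  apply: ler_sum => i _; rewrite ler_wpM2l// lerDl.
  by rewrite (radical_convex_ge0 hf)// divr_ge0.
apply: (@le_trans _ _ (\sum_(i < n) w i * (2^-1 * f m + 2^-1 * f (x i)))).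
  apply: ler_sum => i _; rewrite ler_wpM2l//.
  exact: radical_convex2_parallelogram.
under eq_bigr => i _ do rewrite -mulrDr mulrCA mulrDr.
rewrite -mulr_sumr big_split/= -mulr_suml hsum mul1r.
(* Half of [f m] remains, and Jensen bounds it by half of the target sum. *)
have := jensen_nonneg _ _ _ _ _ cvxf hx w0 hsum; rewrite -/m; lra.
Qed.
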